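(* Let $r\ge2$. Suppose $k_1,k_2,\dots,k_r$ are positive integers, all congruent to $1$ modulo $q-1$, such that $k_1+k_2+\cdots+k_r<1+q+\cdots+q^{r-1}$. Then $\det[\mathcal E_{k_1}\ \mathcal E_{k_2}\ \cdots\ \mathcal E_{k_r}]=0$ identically on $\Omega^r$, where $\mathcal E_k$ denotes the vectorial Eisenstein series of weight $k$ on $\Omega^r$.
   Context: Let $\mathbb{F}_q$ be the finite field with $q$ elements, $A=\mathbb{F}_q[\theta]$, $K_\infty=\mathbb{F}_q((\theta^{-1}))$, and $\mathbb{C}_\infty$ the completion of an algebraic closure of $K_\infty$, with absolute value normalized by $|\theta|=q$. $\mathbb{T}$ is the Tate algebra, the completion of $\mathbb{C}_\infty[t]$ for the Gauss norm $\|\sum f_it^i\|=\max|f_i|$. Let $\chi_t:A\to\mathbb{F}_q[t]\subset\mathbb{T}$ be the $\mathbb{F}_q$-algebra map $\theta\mapsto t$, and $\rho_t$ its entrywise extension to column vectors over $A$. $\Omega^r$ is the set of row vectors $\bm z=(z_r,z_{r-1},\dots,z_1)\in\mathbb{C}_\infty^r$ with $z_1=1$ and $z_1,\dots,z_r$ linearly independent over $K_\infty$. For a positive integer $k$, the vectorial Eisenstein series $\mathcal E_k:\Omega^r\to\mathbb{T}^r$ is $\mathcal E_k(\bm z)=\sum_{0\ne\bm a\in A^r}(\bm z\bm a)^{-k}\rho_t(\bm a)$, where $A^r$ and $\mathbb{T}^r$ consist of column vectors. The series converge in $\mathbb{T}^r$. *)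

(* Defs.v *)
(* Built on MathComp and MathComp-Analysis. *)
From HB Require Import structures.
From mathcomp Require Import all_boot all_order all_algebra finmap.
From mathcomp Require Import boolp classical_sets reals topology normedtype.
From mathcomp Require Import sequences summability.

Set Implicit Arguments.
Unset Strict Implicit.
Unset Printing Implicit Defensive.

Import Order.TTheory GRing.Theory Num.Theory.
Import numFieldNormedType.Exports.

Local Open Scope classical_set_scope.
Local Open Scope ring_scope.

(* MathComp's [normedZmodType] requires [`|x *+ n| = `|x| *+ n], which fails in
   positive characteristic, so ultrametric norms are explicit functions here. *)
Section UltrametricRings.
Context {R : realType}.

Record is_ultranorm (V : nzRingType) (N : V -> R) : Prop := {
  un_ge0 : forall x, 0 <= N x;
  un_eq0 : forall x, N x = 0 <-> x = 0;
  un_ultra : forall x y, N (x - y) <= Num.max (N x) (N y);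
  un_submul : forall x y, N (x * y) <= N x * N y }.

Record is_ultra_abs (K : fieldType) (v : K -> R) : Prop := {
  ua_norm : is_ultranorm v;
  ua_mul : forall x y, v (x * y) = v x * v y }.

Definition ncvg (V : nzRingType) (N : V -> R) (u : nat -> V) (l : V) : Prop :=
  N (u n - l) @[n --> \oo] --> (0 : R).

Definition ncauchy (V : nzRingType) (N : V -> R) (u : nat -> V) : Prop :=
  forall e : R, 0 < e ->
    exists n0 : nat, forall m n : nat,
      (n0 <= m)%N -> (n0 <= n)%N -> N (u m - u n) < e.

Definition ncomplete (V : nzRingType) (N : V -> R) : Prop :=
  forall u : nat -> V, ncauchy N u -> exists l : V, ncvg N u l.

Definition ndense (V : nzRingType) (N : V -> R) (D : set V) : Prop :=
  forall (x : V) (e : R), 0 < e -> exists2 y, D y & N (x - y) < e.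

(* [V], normed by [N], is the completion of [U], normed by [M], along [f]. *)
Record is_completion (U V : nzRingType) (M : U -> R) (N : V -> R)
    (f : {rmorphism U -> V}) : Prop := {
  compl_norm : is_ultranorm N;
  compl_isometry : forall x, N (f x) = M x;
  compl_dense : ndense N (range f);
  compl_complete : ncomplete N }.

(* Unconditional summation, along the finite subsets of the index type. *)
Definition is_nsum (V : nzRingType) (N : V -> R) (I : choiceType)
    (f : I -> V) (l : V) : Prop :=
  N (partial_sum f S - l) @[S --> totally] --> (0 : R).

(* Junk value 0 when the family is not summable. *)
Definition nsum (V : nzRingType) (N : V -> R) (I : choiceType)
    (f : I -> V) : V :=
  xget 0 [set l | is_nsum N f l].

End UltrametricRings.

(* Here [F] is F_q, [A = {poly F}] with 'X in the role of theta, and [C] is a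
   field containing F_q via [iota], with a chosen element [theta]. *)
Section Cinfty.
Context {R : realType} {F : finFieldType} {C : fieldType}.
Variables (v : C -> R) (iota : {rmorphism F -> C}) (theta : C).

(* F_q((1/theta)) inside C: sums of theta^m * \sum_i a_i theta^-i. *)
Definition Kinfty : set C :=
  [set x | exists (m : nat) (a : nat -> F),
     ncvg v (fun n => theta ^+ m * \sum_(i < n) iota (a i) * theta ^- i) x].

Definition Kinfty_alg : set C :=
  [set x | exists p : {poly C},
     [/\ p != 0, forall i, Kinfty p`_i & root p x]].

(* [C] is complete, and the elements algebraic over F_q((1/theta)) form a dense
   subfield that is algebraically closed: [C] is the completion of an algebraic
   closure of F_q((1/theta)). Since F_q is finite, [v] is trivial on it, so
   [Cinf_theta] determines [v] on F_q((1/theta)), hence on all of [C]. *)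
Record is_Cinfty : Prop := {
  Cinf_abs : is_ultra_abs v;
  Cinf_theta : v theta = #|F|%:R;
  Cinf_closed : forall p : {poly C}, (forall i, Kinfty_alg p`_i) ->
    size p != 1%N -> exists2 x, Kinfty_alg x & root p x;
  Cinf_dense : ndense v Kinfty_alg;
  Cinf_complete : ncomplete v }.

Definition gauss_norm (p : {poly C}) : R :=
  \big[Num.max/0]_(i < size p) v p`_i.

Definition A_to_C (a : {poly F}) : C := (map_poly iota a).[theta].

(* Coordinates run as (z_r, ..., z_1), so z_1 is the last one. *)
Definition Omega (r : nat) : set 'rV[C]_r :=
  [set z | (forall i : 'I_r, i.+1 = r -> z 0 i = 1) /\
           (forall c : 'I_r -> C, (forall i, Kinfty (c i)) ->
              \sum_i c i * z 0 i = 0 -> forall i, c i = 0)].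

Section TateAlgebra.
Context {T : comNzRingType}.
Variables (N : T -> R) (j : {rmorphism {poly C} -> T}).

Definition is_Tate : Prop := is_completion gauss_norm N j.

Definition chi_t (a : {poly F}) : T := j (map_poly iota a).

Definition rho_t (r : nat) (a : 'cV[{poly F}]_r) : 'cV[T]_r := map_mx chi_t a.

Definition pairing (r : nat) (z : 'rV[C]_r) (a : 'cV[{poly F}]_r) : C :=
  (z *m map_mx A_to_C a) 0 0.

Definition Eisenstein (r k : nat) (z : 'rV[C]_r) : 'cV[T]_r :=
  \col_i nsum N (fun a : {a : 'cV[{poly F}]_r | a != 0} =>
                   j (pairing z (val a) ^- k)%:P * rho_t (val a) i 0).

End TateAlgebra.
End Cinfty.

(* Main.v *)
Require Import Defs.
From mathcomp Require Import all_boot all_order all_fingroup all_algebra finmap.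
From mathcomp Require Import abelian finfield.
From mathcomp Require Import boolp classical_sets reals normedtype.
From mathcomp Require Import summability.

(* The identity already holds for the partial sums over the vectors [a] of
   degree < d, i.e. over the elements [w = z a] of a finite F_q-subspace [W] of
   [C], of dimension m. An F_q-linear function on [W] is interpolated by a
   q-polynomial \sum_(n < m) c_n X^(q^n), because the Moore matrix of a basis
   of [W] is invertible. Hence the truncated series of weight k is the
   combination of the vectors c_n with coefficients \sum_(w != 0) w^(q^n - k),
   and these power sums vanish when k < q^n. Expanding the determinant along
   the c_n, a nonzero term would have pairwise distinct n_1, ..., n_r with
   q^(n_l) <= k_l for all l, so that 1 + q + ... + q^(r-1) <= \sum_l k_l.
   The truncations converge to the Eisenstein series, since |z a| tends to
   infinity: the lattice spanned by [z] is discrete. *)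

Set Implicit Arguments.
Unset Strict Implicit.
Unset Printing Implicit Defensive.

Import Order.TTheory GRing.Theory Num.Theory.
Import numFieldNormedType.Exports.
Local Open Scope ring_scope.

(** * Determinants of power sums over finite F_q-subspaces *)

(** Sort the values of [f]: in a strictly increasing list of naturals the entry at position [i] is
    at least [i]. *)
Lemma leq_sum_injective (r : nat) (f : 'I_r -> nat) (g : nat -> nat) :
  injective f -> {homo g : m n / (m <= n)%N} ->
  (\sum_(i < r) g i <= \sum_(i < r) g (f i))%N.
Proof.
move=> f_inj g_homo; pose s := sort leq [seq f i | i : 'I_r].
have size_s : size s = r by rewrite size_sort size_map size_enum_ord.
have s_sorted : sorted ltn s.
  rewrite ltn_sorted_uniq_leq sort_uniq map_inj_uniq // enum_uniq.
  exact: (sort_sorted leq_total).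
have nth_ge i : (i < r -> i <= nth 0 s i)%N.
  elim: i => // i IHi ltir.
  apply: leq_ltn_trans (IHi (ltnW ltir)) _.
  by apply: (sortedP 0%N s_sorted); rewrite size_s.
have -> : (\sum_(i < r) g (f i) = \sum_(x <- s) g x)%N.
  by rewrite (perm_big _ (permEl (perm_sort _ _))) big_map big_enum.
rewrite (big_nth 0%N) size_s big_mkord; apply: leq_sum => i _.
exact/g_homo/nth_ge.
Qed.

(** As in the Cauchy-Binet formula, the determinant is a sum over all maps [f] of a product of
    entries [A i (f i)] times the determinant of the rows of [B] chosen by [f]. A non-injective [f]
    repeats a row; an injective one meets a zero entry of [A]. *)
Lemma det_mulmx_eq0 (S : comNzRingType) (r m : nat)
    (A : 'M[S]_(r, m)) (B : 'M[S]_(m, r)) :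
  (forall f : {ffun 'I_r -> 'I_m}, injective f -> exists i, A i (f i) = 0) ->
  \det (A *m B) = 0.
Proof.
move=> A0; pose AB (s : 'S_r) i j := A i j * B j (s i).
transitivity (\sum_(f : {ffun 'I_r -> 'I_m}) \sum_(s : 'S_r)
                (-1) ^+ s * \prod_i AB s i (f i)).
  rewrite exchange_big; apply: eq_bigr => /= s _; rewrite -big_distrr /=.
  congr (_ * _); rewrite -(bigA_distr_bigA (AB s)) /=.
  by apply: eq_bigr => x _; rewrite mxE.
apply: big1 => f _.
transitivity (\det (\matrix_(i, j) B (f i) j) * \prod_i A i (f i)).
  rewrite mulrC big_distrr /=; apply: eq_bigr => s _.
  rewrite mulrCA big_split //=; congr (_ * (_ * _)).
  by apply: eq_bigr => x _; rewrite mxE.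
have [/injectiveP f_inj|/injectivePn[i1 [i2 ne_i eq_f]]] := boolP (injectiveb f).
  by have [i Ai0] := A0 f f_inj; rewrite (bigD1 i) //= Ai0 mul0r mulr0.
by rewrite (determinant_alternate ne_i) ?mul0r // => j; rewrite !mxE eq_f.
Qed.

(** * Additive q-power maps, power sums and the Moore matrix *)

Section FiniteSubspaces.
Variables (F : finFieldType) (C : fieldType) (iota : {rmorphism F -> C}).

(** Scalars act on [S] through [h], so one notion covers maps to [C] and to the Tate algebra. Row
    vectors over [F] serve as coordinates on the subspace [W]. *)
Definition semilinear (S : nzRingType) (h : F -> S) (m : nat)
    (lam : 'rV[F]_m -> S) :=
  forall a x y, lam (a *: x + y) = h a * lam x + lam y.

Section Semilinear.
Variables (S : nzRingType) (h : {rmorphism F -> S}) (m : nat).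
Variables (lam : 'rV[F]_m -> S) (hlam : semilinear h lam).

Lemma semilinear0 : lam 0 = 0.
Proof. by have := hlam (-1) 0 0; rewrite scaler0 addr0 rmorphN1 mulN1r addNr. Qed.

Lemma semilinearD x y : lam (x + y) = lam x + lam y.
Proof. by rewrite -[x in LHS]scale1r hlam rmorph1 mul1r. Qed.

Lemma semilinearZ a x : lam (a *: x) = h a * lam x.
Proof. by rewrite -[X in lam X]addr0 hlam semilinear0 addr0. Qed.

Lemma semilinear_delta x :
  lam x = \sum_(i < m) h (x 0 i) * lam (delta_mx 0 i).
Proof.
rewrite {1}[x]row_sum_delta (big_morph lam semilinearD semilinear0).
by apply: eq_bigr => i _; rewrite semilinearZ.
Qed.

End Semilinear.

(** The characteristic passes from [F] to [C] along [iota], and the additive group of [F] is an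
    elementary abelian p-group. *)
Lemma pchar_pnat_card : exists2 p, p \in [pchar C] & p.-nat #|F|.
Proof.
have [p _ pF] := finPcharP F; exists p; first exact: (rmorph_pchar iota pF).
rewrite -cardsT; exact: (abelem_pgroup (fin_ring_pchar_abelem pF)).
Qed.

Lemma card_natr_eq0 : #|F|%:R = 0 :> C.
Proof.
have [p pC pF] := pchar_pnat_card.
have := finNzRing_gt1 F; have [[|n] ->] := p_natP pF => // _.
by rewrite natrX (pcharf0 pC) expr0n.
Qed.

Lemma exprD_card n (x y : C) :
  (x + y) ^+ (#|F| ^ n) = x ^+ (#|F| ^ n) + y ^+ (#|F| ^ n).
Proof.
have [p pC pF] := pchar_pnat_card.
by apply: exprDn_pchar; rewrite pnatX (eq_pnat _ (pcharf_eq pC)) pF.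
Qed.

Lemma iota_exp_card n a : iota a ^+ (#|F| ^ n) = iota a.
Proof.
elim: n => [|n IHn]; first by rewrite expr1.
by rewrite expnSr exprM IHn -rmorphXn expf_card.
Qed.

Section PowerSums.
Variables (m : nat) (lam : 'rV[F]_m -> C).
Hypotheses (hlam : semilinear iota lam) (lam_inj : forall x, lam x = 0 -> x = 0).

Lemma semilinear_inj : injective lam.
Proof.
move=> x y eq_xy; apply/eqP; rewrite -subr_eq0; apply/eqP/lam_inj.
by rewrite addrC -scaleN1r hlam rmorphN1 eq_xy mulN1r addNr.
Qed.

(** Injectivity of [lam] provides [#|F| ^ m] distinct roots, more than the degree allows. *)
Lemma poly_vanishing_eq0 (p : {poly C}) :
  (size p <= #|F| ^ m)%N -> (forall x, p.[lam x] = 0) -> p = 0.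
Proof.
move=> size_p p0.
apply: (@roots_geq_poly_eq0 _ p [seq lam x | x : 'rV[F]_m]).
- by apply/allP=> _ /mapP[x _ ->]; rewrite rootE p0.
- by rewrite map_inj_uniq ?enum_uniq //; exact: semilinear_inj.
by rewrite size_map -cardE card_mx mul1n.
Qed.

(* The two sides differ by a polynomial in [y] of degree less than [#|W|] that
   vanishes at every point of the subspace [W]. *)
Lemma power_sum_translate e (y : C) : (e < #|F| ^ m)%N ->
  \sum_x (y + lam x) ^+ e = \sum_x lam x ^+ e.
Proof.
move=> lt_e; pose p := \sum_x ('X + (lam x)%:P) ^+ e - (\sum_x lam x ^+ e)%:P.
have pE u : p.[u] = \sum_x (u + lam x) ^+ e - \sum_x lam x ^+ e.
  rewrite !hornerE horner_sum; congr (_ - _).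
  by apply: eq_bigr => x _; rewrite !hornerE.
apply/eqP; rewrite -subr_eq0 -pE.
suff -> : p = 0 by rewrite horner0.
apply: poly_vanishing_eq0.
  apply: leq_trans lt_e.
  apply: leq_trans (size_polyD _ _) _; rewrite geq_max size_polyN.
  rewrite (leq_trans (size_polyC_leq1 _)) ?andbT //.
  apply: leq_trans (size_sum _ _ _) _; apply/bigmax_leqP => x _.
  by rewrite -[(lam x)%:P]opprK -polyCN size_exp_XsubC.
move=> x; rewrite pE; apply/eqP; rewrite subr_eq0; apply/eqP.
rewrite [RHS](reindex_inj (addrI x)); apply: eq_bigr => w _.
by rewrite (semilinearD hlam).
Qed.

End PowerSums.

Lemma power_sum_eq0 m (lam : 'rV[F]_(1 + m) -> C) e :
    semilinear iota lam -> (forall x, lam x = 0 -> x = 0) ->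
    (e < #|F| ^ m)%N ->
  \sum_x lam x ^+ e = 0.
Proof.
move=> hlam lam_inj lt_e.
pose lam0 (x : 'rV[F]_m) := lam (row_mx (0 : 'rV_1) x).
(* Splitting off a line from the space, the inner sums over its translates of
   the hyperplane [lam0] are all equal, and there are [#|F|] of them. *)
have hlam0 : semilinear iota lam0.
  by move=> a x y; rewrite /lam0 -hlam scale_row_mx add_row_mx scaler0 addr0.
have lam0_inj x : lam0 x = 0 -> x = 0.
  move=> /lam_inj /(congr1 (@rsubmx F 1 1 m)).
  by rewrite row_mxKr linear0.
pose h (u : 'rV[F]_1 * 'rV[F]_m) := row_mx u.1 u.2 : 'rV[F]_(1 + m).
rewrite (reindex h) /=; last first.
  exists (fun x : 'rV[F]_(1 + m) => (lsubmx x, rsubmx x)) => [[x y]|x] _ /=.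
    by rewrite /h row_mxKl row_mxKr.
  exact: hsubmxK.
rewrite -(pair_bigA _ (fun a x => lam (row_mx a x) ^+ e)) /=.
transitivity (\sum_(a : 'rV[F]_1) \sum_x lam0 x ^+ e).
  apply: eq_bigr => a _.
  rewrite -(power_sum_translate hlam0 lam0_inj (lam (row_mx a 0 : 'rV_(1 + m)))) //.
  apply: eq_bigr => x _; rewrite -(semilinearD hlam).
  by rewrite add_row_mx addr0 add0r.
by rewrite sumr_const card_mx expn1 -mulr_natl card_natr_eq0 mul0r.
Qed.

(** A row [u] in the left kernel is the coefficient vector of a q-polynomial that vanishes on a
    basis of [W], hence by F_q-linearity on all of [W]; its degree is below [#|F| ^ m], so it is
    zero. *)
Lemma Moore_unit m (lam : 'rV[F]_m -> C) :
    semilinear iota lam -> (forall x, lam x = 0 -> x = 0) ->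
  (\matrix_(n < m, i < m) lam (delta_mx 0 i) ^+ (#|F| ^ n)) \in unitmx.
Proof.
move=> hlam lam_inj; rewrite -row_free_unit; apply: inj_row_free => u u0.
pose p : {poly C} := \sum_(n < m) u 0 n *: 'X^(#|F| ^ n).
have p0 : p = 0.
  apply: (poly_vanishing_eq0 hlam lam_inj).
    apply: leq_trans (size_sum _ _ _) _; apply/bigmax_leqP => n _.
    apply: leq_trans (size_scale_leq _ _) _; rewrite size_polyXn.
    by rewrite ltn_exp2l // finNzRing_gt1.
  move=> x; rewrite horner_sum (semilinear_delta hlam).
  transitivity (\sum_(i < m) iota (x 0 i) *
     \sum_(n < m) u 0 n * lam (delta_mx 0 i) ^+ (#|F| ^ n)).
    under [RHS]eq_bigr do rewrite mulr_sumr.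
    rewrite exchange_big; apply: eq_bigr => n _ /=.
    (* The power map is additive, and [expr0n] leaves a boolean value for the power of 0, which is 0
       because the exponent is positive. *)
    rewrite !hornerE (big_morph _ (exprD_card n) (expr0n _ _)).
    rewrite expn_eq0 -leqn0 leqNgt (ltnW (finNzRing_gt1 F)) /= mulr_sumr.
    by apply: eq_bigr => i _; rewrite exprMn iota_exp_card mulrCA.
  apply: big1 => i _; move/rowP: u0 => /(_ i); rewrite !mxE.
  by under eq_bigr do rewrite mxE; move=> ->; rewrite mulr0.
(* The exponents are pairwise distinct, so each entry of [u] is a coefficient of [p]. *)
apply/rowP=> n; rewrite mxE; move/polyP: p0 => /(_ (#|F| ^ n)%N).
rewrite coef0 coef_sum (bigD1 n) //= coefZ coefXn eqxx mulr1 big1 ?addr0 //.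
move=> i ne_in; rewrite coefZ coefXn eqn_exp2l ?finNzRing_gt1 //.
by rewrite val_eqE eq_sym (negPf ne_in) mulr0.
Qed.

(** * Interpolation by q-polynomials and determinants of truncated sums *)

Variables (S : comNzRingType) (g : {rmorphism C -> S}).

(** The Moore matrix is inverted over [C] and its inverse carried to [S] by [g]; this fits the
    values on the basis, and semilinearity of both sides extends the equality. *)
Lemma semilinear_interpolation m (lam : 'rV[F]_m -> C) (f : 'rV[F]_m -> S) :
    semilinear iota lam -> (forall x, lam x = 0 -> x = 0) ->
    semilinear (g \o iota) f ->
  exists c : 'I_m -> S,
    forall x, f x = \sum_(n < m) c n * g (lam x ^+ (#|F| ^ n)).
Proof.
move=> hlam lam_inj hf; have M_unit := Moore_unit hlam lam_inj.
set M := (\matrix_(n, i) _) in M_unit.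
pose c := (\row_i f (delta_mx 0 i)) *m map_mx g (invmx M).
exists (c 0) => x.
have cM : c *m map_mx g M = \row_i f (delta_mx 0 i).
  by rewrite -mulmxA -map_mxM mulVmx // map_mx1 mulmx1.
rewrite (semilinear_delta hf) (semilinear_delta hlam).
transitivity (\sum_(i < m) g (iota (x 0 i)) *
   \sum_(n < m) c 0 n * g (lam (delta_mx 0 i) ^+ (#|F| ^ n))).
  apply: eq_bigr => i _; congr (_ * _).
  have /rowP/(_ i) := cM; rewrite [RHS]mxE => <-; rewrite mxE.
  by apply: eq_bigr => n _; rewrite !mxE.
under eq_bigr do rewrite mulr_sumr.
rewrite exchange_big; apply: eq_bigr => n _ /=.
rewrite (big_morph _ (exprD_card n) (expr0n _ _)).
rewrite expn_eq0 -leqn0 leqNgt (ltnW (finNzRing_gt1 F)) /=.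
rewrite rmorph_sum mulr_sumr.
by apply: eq_bigr => i _; rewrite exprMn iota_exp_card rmorphM mulrCA.
Qed.

(** The exponent [#|F| ^ n - k] is positive, so the term at 0 can be added for free, and it is less
    than [#|F| ^ (m - 1)], so [power_sum_eq0] applies. *)
Lemma power_sum_shift_eq0 m (lam : 'rV[F]_m -> C) (n : 'I_m) k :
    semilinear iota lam -> (forall x, lam x = 0 -> x = 0) ->
    (0 < k)%N -> (k < #|F| ^ n)%N ->
  \sum_(x | x != 0) lam x ^- k * lam x ^+ (#|F| ^ n) = 0.
Proof.
case: m lam n => [lam []//|m] lam n hlam lam_inj k_gt0 lt_k.
transitivity (\sum_x lam x ^+ (#|F| ^ n - k)).
  rewrite [RHS](bigD1 0) //= (semilinear0 hlam) expr0n subn_eq0 leqNgt lt_k.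
  rewrite add0r; apply: eq_bigr => x x0.
  rewrite -[X in _ * _ ^+ X](subnK (ltnW lt_k)) exprD mulrCA mulVf ?mulr1 //.
  by rewrite expf_neq0 //; apply: contra_neq x0; exact: lam_inj.
apply: (power_sum_eq0 hlam lam_inj).
rewrite (@leq_trans (#|F| ^ n)%N) //; first by rewrite ltn_subrL k_gt0 (leq_trans _ lt_k).
by rewrite leq_exp2l ?finNzRing_gt1 // -ltnS.
Qed.

(** Interpolation factors the transposed matrix as a matrix [P] of power sums times the matrix of
    interpolation coefficients, which is the setting of [det_mulmx_eq0]. *)
Lemma det_power_sum_eq0 (r m : nat) (lam : 'rV[F]_m -> C)
    (f : 'I_r -> 'rV[F]_m -> S) (k : 'I_r -> nat) :
    semilinear iota lam -> (forall x, lam x = 0 -> x = 0) ->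
    (forall i, semilinear (g \o iota) (f i)) ->
    (forall l, (0 < k l)%N) ->
    (\sum_(l < r) k l < \sum_(i < r) #|F| ^ i)%N ->
  \det (\matrix_(i < r, l < r) \sum_(x | x != 0) g (lam x ^- k l) * f i x) = 0.
Proof.
move=> hlam lam_inj hf k_gt0 hk.
have /fin_all_exists[c cE] i := semilinear_interpolation hlam lam_inj (hf i).
pose P := \matrix_(l < r, n < m)
  g (\sum_(x | x != 0) lam x ^- k l * lam x ^+ (#|F| ^ n)).
rewrite -det_tr.
have -> : (\matrix_(i, l) \sum_(x | x != 0) g (lam x ^- k l) * f i x)^T
        = P *m \matrix_(n < m, i < r) c i n.
  apply/matrixP=> l i; rewrite !mxE.
  under eq_bigr do rewrite cE mulr_sumr.
  rewrite exchange_big; apply: eq_bigr => n _ /=; rewrite !mxE.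
  rewrite rmorph_sum mulr_suml; apply: eq_bigr => x _.
  by rewrite rmorphM -mulrA [g _ * c i n]mulrC.
apply: det_mulmx_eq0 => s s_inj.
suff [l lt_l] : exists l, (k l < #|F| ^ s l)%N.
  by exists l; rewrite mxE power_sum_shift_eq0 // rmorph0.
(* Otherwise [k l] is at least [#|F| ^ s l] for all [l]; as the [s l] are distinct, the weights
   would sum to at least [1 + q + ... + q^(r-1)]. *)
apply/existsP; apply: contraTT hk; rewrite negb_exists -leqNgt => /forallP ge_k.
apply: (@leq_trans (\sum_(l < r) #|F| ^ s l)%N); last first.
  by apply: leq_sum => l _; rewrite leqNgt.
apply: (@leq_sum_injective r (fun l => s l : nat) (expn #|F|)).
  by move=> l1 l2 /val_inj/s_inj.
by move=> a b leab; rewrite leq_exp2l // finNzRing_gt1.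
Qed.

End FiniteSubspaces.

(** * Convergence for ultrametric norms *)

#[local] Existing Instance totally_filter.

Section Ultranorms.
Variables (R : realType) (V : nzRingType) (N : V -> R).
Hypothesis N_norm : is_ultranorm N.

Lemma ultranorm0 : N 0 = 0.
Proof. exact/(un_eq0 N_norm). Qed.

Lemma ultranormN x : N (- x) = N x.
Proof.
have le y : N (- y) <= N y.
  by rewrite -sub0r (le_trans (un_ultra N_norm _ _)) // ultranorm0 max_r // un_ge0.
by apply/eqP; rewrite eq_le le /= -{1}[x]opprK le.
Qed.

Lemma ultranorm_distC x y : N (x - y) = N (y - x).
Proof. by rewrite -opprB ultranormN. Qed.

Lemma ultranormD_le x y e : N x <= e -> N y <= e -> N (x + y) <= e.
Proof.
move=> xe ye; rewrite -[y]opprK (le_trans (un_ultra N_norm _ _)) //.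
by rewrite ultranormN ge_max xe.
Qed.

Lemma ultranorm_dist_le x y w e :
  N (x - y) <= e -> N (y - w) <= e -> N (x - w) <= e.
Proof. by move=> xy yw; rewrite -(subrKA y) ultranormD_le. Qed.

Lemma ultranorm_sum_le (I : Type) (s : seq I) (P : pred I) (f : I -> V) e :
  0 <= e -> (forall i, P i -> N (f i) <= e) -> N (\sum_(i <- s | P i) f i) <= e.
Proof.
move=> e0 fe; elim/big_ind: _ => [|x y|//]; first by rewrite ultranorm0.
exact: ultranormD_le.
Qed.

(** With weak inequalities, ultrametric estimates chain at the same [e], without halving. *)
Lemma ncvgP (u : nat -> V) l : ncvg N u l <->
  forall e, 0 < e -> exists n0, forall n, (n0 <= n)%N -> N (u n - l) <= e.
Proof.
split=> [/cvgrPdist_le ul e e0|ul].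
  have [n0 _ un] := ul _ e0; exists n0 => n /un /=.
  by rewrite sub0r normrN ger0_norm // un_ge0.
apply/cvgrPdist_le => e e0; have [n0 un] := ul _ e0; exists n0 => // n /un /=.
by rewrite sub0r normrN ger0_norm // un_ge0.
Qed.

Lemma ncvg_unique (u : nat -> V) l l' : ncvg N u l -> ncvg N u l' -> l = l'.
Proof.
move=> /ncvgP ul /ncvgP ul'; apply/eqP; rewrite -subr_eq0; apply/eqP.
apply/(un_eq0 N_norm)/eqP; rewrite eq_le un_ge0 // andbT.
apply/ler_addgt0Pr => e e0; rewrite add0r.
have [n un] := ul _ e0; have [n' un'] := ul' _ e0.
apply: (@ultranorm_dist_le _ (u (maxn n n'))); last by rewrite un' ?leq_maxr.
by rewrite ultranorm_distC un ?leq_maxl.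
Qed.

Lemma ncvg_cst l : ncvg N (fun=> l) l.
Proof. by apply/ncvgP => e /ltW e0; exists 0%N => n _; rewrite subrr ultranorm0. Qed.

Lemma ncvgD (u u' : nat -> V) l l' :
  ncvg N u l -> ncvg N u' l' -> ncvg N (fun n => u n + u' n) (l + l').
Proof.
move=> /ncvgP ul /ncvgP ul'; apply/ncvgP => e e0.
have [n un] := ul _ e0; have [n' un'] := ul' _ e0.
exists (maxn n n') => i; rewrite geq_max => /andP[ni n'i].
by rewrite opprD addrACA ultranormD_le ?un ?un'.
Qed.

Lemma ncvgM (u u' : nat -> V) l l' :
  ncvg N u l -> ncvg N u' l' -> ncvg N (fun n => u n * u' n) (l * l').
Proof.
move=> /ncvgP ul /ncvgP ul'; apply/ncvgP => e e0.
have [n0 un0] := ul _ ltr01.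
(* [B] bounds both [N l'] and, once [u i] is within 1 of [l], [N (u i)]. *)
pose B := 1 + N l + N l'.
have Nl0 := un_ge0 N_norm l; have Nl'0 := un_ge0 N_norm l'.
have B0 : 0 < B by rewrite /B -addrA ltr_pwDl // addr_ge0.
have eB0 : 0 < e / B by rewrite divr_gt0.
have [n un] := ul _ eB0; have [n' un'] := ul' _ eB0.
exists (maxn n0 (maxn n n')) => i; rewrite !geq_max => /and3P[n0i ni n'i].
have -> : u i * u' i - l * l' = u i * (u' i - l') + (u i - l) * l'.
  by rewrite mulrBr mulrBl subrKA.
apply: ultranormD_le; apply: le_trans (un_submul N_norm _ _) _.
  rewrite -(divfK (lt0r_neq0 B0) e) mulrC ler_pM ?un_ge0 ?un' //.
  rewrite -[u i](subrK l); apply: ultranormD_le; last by rewrite /B addrAC lerDr addr_ge0.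
  by apply: le_trans (un0 _ n0i) _; rewrite /B -addrA lerDl addr_ge0.
rewrite -(divfK (lt0r_neq0 B0) e) ler_pM ?un_ge0 ?un //.
by rewrite /B lerDr addr_ge0.
Qed.

Lemma ncvg_sum (I : Type) (s : seq I) (P : pred I) (u : I -> nat -> V) l :
  (forall i, P i -> ncvg N (u i) (l i)) ->
  ncvg N (fun n => \sum_(i <- s | P i) u i n) (\sum_(i <- s | P i) l i).
Proof.
move=> ul; elim: s => [|i s IHs].
  by under eq_fun do rewrite big_nil; rewrite big_nil; exact: ncvg_cst.
under eq_fun do rewrite big_cons; rewrite big_cons.
by case: ifP => // Pi; exact: ncvgD (ul _ Pi) IHs.
Qed.

Lemma ncvg_prod (I : Type) (s : seq I) (P : pred I) (u : I -> nat -> V) l :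
  (forall i, P i -> ncvg N (u i) (l i)) ->
  ncvg N (fun n => \prod_(i <- s | P i) u i n) (\prod_(i <- s | P i) l i).
Proof.
move=> ul; elim: s => [|i s IHs].
  by under eq_fun do rewrite big_nil; rewrite big_nil; exact: ncvg_cst.
under eq_fun do rewrite big_cons; rewrite big_cons.
by case: ifP => // Pi; exact: ncvgM (ul _ Pi) IHs.
Qed.

(** The difference is a sum over indices outside [A], so it is no larger than its largest term. *)
Lemma partial_sum_tail_le (I : choiceType) (f : I -> V) (A B : {fset I}) e :
    (A `<=` B)%fset -> 0 <= e -> (forall i, i \notin A -> N (f i) <= e) ->
  N (partial_sum f B - partial_sum f A) <= e.
Proof.
move=> AB e0 fe; rewrite /partial_sum -!(big_seq_fsetE _ _ predT) /=.
rewrite (big_fsetID _ (mem A)) /=.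
have -> : [fset x in B | x \in A]%fset = A.
  apply/fsetP=> x; rewrite !inE /= andbC; case xA: (x \in A) => //=.
  exact: (fsubsetP AB).
rewrite addrAC subrr add0r big_seq; apply: ultranorm_sum_le => // i.
by rewrite !inE /= => /andP[_]; exact: fe.
Qed.

(** In a complete ultrametric ring, terms tending to zero suffice for summability; this rules out
    the junk value of [nsum]. *)
Lemma ncvg_nsum (I : choiceType) (f : I -> V) (S : nat -> {fset I}) :
    ncomplete N ->
    (forall m n, (m <= n)%N -> (S m `<=` S n)%fset) ->
    (forall e, 0 < e -> exists n, forall i, i \notin S n -> N (f i) <= e) ->
  ncvg N (fun n => partial_sum f (S n)) (nsum N f).
Proof.
move=> N_compl S_mono f_small.
have tail e : 0 < e -> exists n, forall A : {fset I}, (S n `<=` A)%fset ->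
    N (partial_sum f A - partial_sum f (S n)) <= e.
  move=> e0; have [n fn] := f_small _ e0; exists n => A SA.
  by rewrite partial_sum_tail_le // ltW.
have [l ul] : exists l, ncvg N (fun n => partial_sum f (S n)) l.
  (* Halving turns the weak tail bound into the strict one of [ncauchy]. *)
  apply: N_compl => e e0; have e20 : 0 < e / 2 by rewrite divr_gt0.
  have [n0 un] := tail _ e20; exists n0 => m n m0 n0n.
  have e2e : e / 2 < e by rewrite ltr_pdivrMr // ltr_pMr // ltr1n.
  apply: le_lt_trans e2e; apply: (@ultranorm_dist_le _ (partial_sum f (S n0))).
    exact/un/S_mono.
  by rewrite ultranorm_distC; exact/un/S_mono.
have fl : is_nsum N f l.
  apply/cvgrPdist_le => e e0; have [n un] := tail _ e0.
  have /ncvgP/(_ _ e0)[n' un'] := ul.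
  exists (S (maxn n n')) => //= A SA.
  rewrite sub0r normrN ger0_norm ?un_ge0 //.
  have SnA : (S n `<=` A)%fset by rewrite (fsubset_trans _ SA) ?S_mono ?leq_maxl.
  apply: (@ultranorm_dist_le _ (partial_sum f (S n))); first exact: un.
  apply: (@ultranorm_dist_le _ (partial_sum f (S (maxn n n')))).
    by rewrite ultranorm_distC; apply: un; rewrite S_mono ?leq_maxl.
  by apply: un'; rewrite leq_maxr.
(* [nsum] picks some sum, not visibly [l]; convergence to it is checked directly, by enlarging [S m]
   to a set [A] on which its defining estimate holds. *)
have fs : is_nsum N f (nsum N f) by rewrite /nsum; apply: xgetPex; exists l.
apply/ncvgP => e e0; have [n un] := tail _ e0.
move/cvgrPdist_le: fs => /(_ _ e0)[A0 _ A0P].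
exists n => m nm; pose A := (A0 `|` S m)%fset.
have Sm := S_mono _ _ nm.
apply: (@ultranorm_dist_le _ (partial_sum f (S n))); first exact: un.
apply: (@ultranorm_dist_le _ (partial_sum f A)).
  by rewrite ultranorm_distC; apply/un/(fsubset_trans Sm)/fsubsetUr.
have /= := A0P A (fsubsetUl _ _).
by rewrite sub0r normrN ger0_norm // un_ge0.
Qed.

End Ultranorms.

Lemma ncvg_det (R : realType) (S : comNzRingType) (N : S -> R) (n : nat)
    (u : nat -> 'M[S]_n) (M : 'M[S]_n) :
    is_ultranorm N -> (forall i l, ncvg N (fun d => u d i l) (M i l)) ->
  ncvg N (fun d => \det (u d)) (\det M).
Proof.
move=> N_norm uM; apply: (ncvg_sum N_norm) => s _.
apply: (ncvgM N_norm); first exact: ncvg_cst.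
by apply: (ncvg_prod N_norm) => i _; exact: uM.
Qed.

(** Compactness of sequences over a finite alphabet. A prefix is [good] when [X d] starts with it
    for arbitrarily large [d]; by pigeonhole a good prefix has a good extension by one letter. *)
Lemma Koenig (W : finType) (X : nat -> nat -> W) :
  exists s : nat -> W, forall n M : nat,
    exists2 d, (M <= d)%N & forall t, (t < n)%N -> X d t = s t.
Proof.
pose good (p : seq W) := forall M, exists2 d, (M <= d)%N &
  forall t, (t < size p)%N -> Some (X d t) = onth p t.
have good_rcons p : exists w, good p -> good (rcons p w).
  (* For a prefix that is not good any letter will do; [X] supplies one. *)
  have [gp|gp] := EM (good p); last by exists (X 0%N 0%N) => /gp.
  apply: contrapT => /forallNP no_w.
  (* If every letter failed, each would have a bound past which it never follows [p]; past the
     maximum of these bounds no letter could follow. *)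
  have /fin_all_exists[M MP] w : exists M, forall d, (M <= d)%N ->
      (forall t, (t < size p)%N -> Some (X d t) = onth p t) -> X d (size p) <> w.
    apply: contrapT => /forallNP bad; apply: (no_w w) => _ M.
    have /existsNP[d /not_implyP[Md /not_implyP[dP /contrapT dw]]] := bad M.
    exists d => // t; rewrite size_rcons ltnS leq_eqVlt => /predU1P[->|ltp].
      by rewrite dw -cats1 onth_cat ltnn subnn.
    by rewrite dP // -cats1 onth_cat ltp.
  have [d Md dP] := gp (\max_w M w).
  by apply: (MP (X d (size p)) d) => //; rewrite (leq_trans _ Md) // leq_bigmax.
have [g gP] := choice good_rcons.
pose P n := iter n (fun p => rcons p (g p)) [::].
have goodP n : good (P n) by elim: n => [M|n IHn]; [exists M | exact: gP].
have sizeP n : size (P n) = n by elim: n => //= n IHn; rewrite size_rcons IHn.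
have nthP n t : (t < n)%N -> onth (P n) t = Some (g (P t)).
  elim: n => // n IHn; rewrite ltnS leq_eqVlt => /predU1P[->|ltn] /=.
    by rewrite -cats1 onth_cat sizeP ltnn subnn.
  by rewrite -cats1 onth_cat sizeP ltn IHn.
exists (fun t => g (P t)) => n M; have [d Md dP] := goodP n M; exists d => // t ltn.
by have := dP t; rewrite sizeP nthP // => /(_ ltn)[].
Qed.

(** * The lattice of z and the Eisenstein series *)

Section Cinfty.
Variables (R : realType) (F : finFieldType) (C : fieldType) (v : C -> R).
Variables (iota : {rmorphism F -> C}) (theta : C).
Hypothesis hC : is_Cinfty v iota theta.

Let v_norm : is_ultranorm v := ua_norm (Cinf_abs hC).
Let vM x y : v (x * y) = v x * v y. Proof. exact: ua_mul (Cinf_abs hC) x y. Qed.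
Let v_ge0 x : 0 <= v x. Proof. exact: un_ge0. Qed.

Let v_eq0 x : (v x == 0) = (x == 0).
Proof. by apply/eqP/eqP => /(un_eq0 v_norm). Qed.

Lemma Cabs1 : v 1 = 1.
Proof.
have v1 : v 1 != 0 by rewrite v_eq0 oner_eq0.
by apply: (mulfI v1); rewrite -vM !mulr1.
Qed.

Lemma CabsX x n : v (x ^+ n) = v x ^+ n.
Proof. by elim: n => [|n IHn]; rewrite ?expr0 ?Cabs1 // !exprS vM IHn. Qed.

Lemma CabsV x : v x^-1 = (v x)^-1.
Proof.
have [->|x0] := eqVneq x 0; first by rewrite invr0 (ultranorm0 v_norm) invr0.
have vx0 : v x != 0 by rewrite v_eq0.
by apply: (mulfI vx0); rewrite -vM !divff ?Cabs1.
Qed.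

(** From [a ^+ #|F| = a], the absolute value is a nonnegative real root of unity. *)
Lemma Cabs_iota a : a != 0 -> v (iota a) = 1.
Proof.
move=> a0; have va0 : v (iota a) != 0 by rewrite v_eq0 fmorph_eq0.
have := congr1 (fun x => v (iota x)) (expf_card a).
have : (1 < #|F|)%N := finNzRing_gt1 F.
case: #|F| => [|[|n]] // _; rewrite rmorphXn CabsX exprS -[RHS]mulr1.
by move=> /(mulfI va0)/eqP; rewrite pexprn_eq1 //= => /eqP.
Qed.

Lemma Cabs_iota_le1 a : v (iota a) <= 1.
Proof.
have [->|/Cabs_iota-> //] := eqVneq a 0.
by rewrite rmorph0 (ultranorm0 v_norm) ler01.
Qed.

(** * Expansions in powers of 1/theta *)

Let q : R := #|F|%:R.
Let q_gt0 : 0 < q. Proof. by rewrite ltr0n (ltnW (finNzRing_gt1 F)). Qed.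
Let q_ge1 : 1 <= q. Proof. by rewrite ler1n (ltnW (finNzRing_gt1 F)). Qed.
Let v_theta : v theta = q. Proof. exact: Cinf_theta hC. Qed.

Let theta_neq0 : theta != 0.
Proof. by rewrite -v_eq0 v_theta gt_eqF. Qed.

Lemma exists_geometric_le (B e : R) : 0 < e -> exists n, q ^- n * B <= e.
Proof.
move=> e0; exists (Num.bound (`|B| / e)); set n := Num.bound _.
have Bn : `|B| / e < n%:R by apply: archi_boundP; rewrite divr_ge0 // ltW.
rewrite mulrC ler_pdivrMr ?exprn_gt0 // (le_trans (ler_norm B)) //.
rewrite mulrC -ler_pdivrMr // (le_trans (ltW Bn)) // -natrX ler_nat.
by rewrite ltnW // ltn_expl // finNzRing_gt1.
Qed.

Lemma geometric_le (m n : nat) : (m <= n)%N -> q ^- n <= q ^- m.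
Proof. by move=> le_mn; rewrite lef_pV2 ?posrE ?exprn_gt0 // ler_weXn2l. Qed.

Definition digit_sum (s : nat -> F) n : C := \sum_(i < n) iota (s i) * theta ^- i.

Lemma digit_sum_dist_le s m n : (m <= n)%N ->
  v (digit_sum s n - digit_sum s m) <= q ^- m.
Proof.
move=> le_mn; rewrite /digit_sum -!(big_mkord predT (fun i => iota (s i) * theta ^- i)).
rewrite (big_cat_nat (leq0n m) le_mn) /= addrAC subrr add0r big_nat_cond.
apply: (ultranorm_sum_le v_norm) => [|i /andP[/andP[le_mi _] _]].
  by rewrite invr_ge0 exprn_ge0 // ltW.
rewrite vM CabsV CabsX v_theta; apply: le_trans (geometric_le le_mi).
by rewrite ler_piMl ?Cabs_iota_le1 // invr_ge0 exprn_ge0 // ltW.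
Qed.

Lemma digit_sum_cvg s : exists2 c, Kinfty v iota theta c &
  forall n, v (c - digit_sum s n) <= q ^- n.
Proof.
have [c sc] : exists c, ncvg v (digit_sum s) c.
  apply: (Cinf_complete hC) => e e0; have e20 : 0 < e / 2 by rewrite divr_gt0.
  have [n0 n0P] := exists_geometric_le 1 e20; rewrite mulr1 in n0P.
  exists n0 => m n n0m n0n.
  have e2e : e / 2 < e by rewrite ltr_pdivrMr // ltr_pMr // ltr1n.
  apply: le_lt_trans e2e; apply: (@ultranorm_dist_le _ _ _ v_norm _ (digit_sum s n0)).
    exact: le_trans (digit_sum_dist_le _ n0m) n0P.
  rewrite (ultranorm_distC v_norm).
  exact: le_trans (digit_sum_dist_le _ n0n) n0P.
exists c => [|n].
  exists 0%N, s; congr (ncvg v _ c): sc; apply/funext => n.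
  by rewrite expr0 mul1r.
have qn_gt0 : 0 < q ^- n by rewrite invr_gt0 exprn_gt0.
have [n0 n0P] := (ncvgP v_norm _ _).1 sc _ qn_gt0.
apply: (@ultranorm_dist_le _ _ _ v_norm _ (digit_sum s (maxn n n0))).
  by rewrite (ultranorm_distC v_norm) n0P ?leq_maxr.
by rewrite digit_sum_dist_le ?leq_maxl.
Qed.

(** With one digit the error is at most [1/q], while a nonzero constant has absolute value 1. *)
Lemma digit_sum_limit_neq0 s c :
  (forall n, v (c - digit_sum s n) <= q ^- n) -> c = 0 -> s 0%N = 0.
Proof.
move=> sc c0; apply: contraTeq (sc 1%N) => s0.
rewrite c0 sub0r (ultranormN v_norm) /digit_sum big_ord1 expr0 invr1 mulr1.
by rewrite Cabs_iota // expr1 -ltNge invf_lt1 // ltr1n finNzRing_gt1.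
Qed.

(** Division by [theta ^+ D] reverses the coefficients. Past [D] the digit is set to 0, since
    truncated subtraction would return the constant coefficient. *)
Lemma A_to_C_digits (p : {poly F}) D : (size p <= D.+1)%N ->
  theta ^- D * A_to_C iota theta p =
    digit_sum (fun t => if (t <= D)%N then p`_(D - t) else 0) D.+1.
Proof.
move=> size_p; rewrite /A_to_C (@horner_coef_wide _ D.+1) ?size_map_poly //.
rewrite mulr_sumr /digit_sum (reindex_inj rev_ord_inj); apply: eq_bigr => i _.
have leiD : (i <= D)%N by rewrite -ltnS.
rewrite /= subSS coef_map /= leiD mulrCA; congr (_ * _).
rewrite -[in theta ^- D](subnK leiD) exprD invfM mulrAC mulVf ?mul1r //.
by rewrite expf_neq0.
Qed.

(** * Discreteness of the lattice spanned by z *)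

Section Lattice.
Variables (r : nat) (z : 'rV[C]_r).

Lemma pairingE (a : 'cV[{poly F}]_r) :
  pairing iota theta z a = \sum_i A_to_C iota theta (a i 0) * z 0 i.
Proof. by rewrite /pairing mxE; apply: eq_bigr => i _; rewrite !mxE mulrC. Qed.

Lemma pairing_scale_polyC (c : F) (a b : 'cV[{poly F}]_r) :
  pairing iota theta z (c%:P *: a + b) =
    iota c * pairing iota theta z a + pairing iota theta z b.
Proof.
rewrite !pairingE mulr_sumr -big_split; apply: eq_bigr => i _ /=.
by rewrite !mxE /A_to_C rmorphD rmorphM /= map_polyC hornerD hornerM hornerC mulrDl mulrA.
Qed.

Lemma pairing_scaleXn n (a : 'cV[{poly F}]_r) :
  pairing iota theta z ('X^n *: a) = theta ^+ n * pairing iota theta z a.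
Proof.
rewrite !pairingE mulr_sumr; apply: eq_bigr => i _.
by rewrite !mxE /A_to_C rmorphM /= map_polyXn hornerM hornerXn mulrA.
Qed.

Hypothesis hz : Omega v iota theta z.

(* Otherwise there are vectors [a] of arbitrarily large degree [D] with
   [z a] bounded; a limit of [theta ^- D * a] along a subsequence, digit by
   digit, is a nonzero vector over K_infty that is orthogonal to [z]. *)
Lemma lattice_discrete (B : R) : exists d, forall a : 'cV[{poly F}]_r,
  (exists i, (d < size (a i 0%R))%N) -> B < v (pairing iota theta z a).
Proof.
apply: contrapT => /forallNP unbounded.
have /choice[a aP] d : exists a : 'cV[{poly F}]_r,
    (exists i, (d < size (a i 0%R))%N) /\ v (pairing iota theta z a) <= B.
  have /existsNP[a /not_implyP[ad /negP]] := unbounded d.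
  by rewrite -leNgt => aB; exists a.
pose D d := (\max_i size (a d i 0%R)).-1.
have D_ge d : (d <= D d)%N.
  have [[i di] _] := aP d; rewrite /D -ltnS (leq_trans di) //.
  rewrite prednK; first exact: (@leq_bigmax _ (fun i => size (a d i 0%R))).
  by apply: leq_trans (@leq_bigmax _ (fun i => size (a d i 0%R)) i); exact: leq_trans di.
have size_a d i : (size (a d i 0%R) <= (D d).+1)%N.
  by rewrite (leq_trans _ (leqSpred _)) // (@leq_bigmax _ (fun i => size (a d i 0%R))).
(* The digits of [theta ^- D d * a d], where [D d] is the largest degree in [a d]. Digit 0 is
   nonzero, as it contains the leading coefficient of an entry of maximal size. *)
pose X d t := \col_i (if (t <= D d)%N then (a d i 0)`_(D d - t) else 0) : 'cV[F]_r.
have X0 d : X d 0%N != 0.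
  have [[i di] _] := aP d.
  have r_gt0 : (0 < #|'I_r|)%N by apply/card_gt0P; exists i.
  have [i0 i0E] := @bigop.eq_bigmax _ (fun i => size (a d i 0)) r_gt0.
  apply/eqP => /colP/(_ i0); rewrite !mxE leq0n subn0 /D i0E => /eqP.
  rewrite -/(lead_coef _) lead_coef_eq0 => /eqP a0.
  have := leq_bigmax (F := fun i => size (a d i 0%R)) i.
  by rewrite i0E a0 size_poly0 leqNgt (leq_ltn_trans _ di).
have [s sP] := Koenig X.
have /fin_all_exists2[c cK cP] i := digit_sum_cvg (fun t => s t i 0).
have cz0 : \sum_i c i * z 0 i = 0.
  apply/(un_eq0 v_norm)/eqP; rewrite eq_le v_ge0 andbT.
  apply/ler_addgt0Pr => e e0; rewrite add0r.
  pose M := Num.max B (\sum_i v (z 0 i)).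
  have M0 : 0 <= M by rewrite /M le_max sumr_ge0 ?orbT.
  have zM i : v (z 0 i) <= M.
    by rewrite /M le_max (bigD1 i) //= lerDl sumr_ge0 ?orbT.
  have [n nP] := exists_geometric_le M e0; apply: le_trans nP.
  have qn0 : 0 <= q ^- n by rewrite invr_ge0 exprn_ge0 // ltW.
  (* The rescaled [a d] agrees with the limit in the first [n] digits, so its pairing [y] with [z]
     is within [q ^- n * M] of the sum; and [y] itself is that small because [D d] is at least
     [n]. *)
  have [d nd dP] := sP n n; have nD := leq_trans nd (D_ge d).
  pose y := \sum_i (theta ^- D d * A_to_C iota theta (a d i 0)) * z 0 i.
  rewrite -[X in v X](subrK y); apply: (ultranormD_le v_norm).
    rewrite /y -sumrB; apply: (ultranorm_sum_le v_norm) => [|i _].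
      exact: mulr_ge0.
    rewrite -mulrBl vM ler_pM //.
    apply: (@ultranorm_dist_le _ _ _ v_norm _ (digit_sum (fun t => s t i 0) n)) => //.
    rewrite A_to_C_digits // (ultranorm_distC v_norm).
    have -> : digit_sum (fun t => s t i 0) n = digit_sum (fun t => X d t i 0) n.
      by apply: eq_bigr => t _; rewrite dP.
    have -> : digit_sum (fun t => X d t i 0) n = digit_sum
        (fun t => if (t <= D d)%N then (a d i 0)`_(D d - t) else 0) n.
      by apply: eq_bigr => t _; rewrite mxE.
    exact/digit_sum_dist_le/leqW.
  have -> : y = theta ^- D d * pairing iota theta z (a d).
    by rewrite pairingE mulr_sumr; apply: eq_bigr => i _; rewrite mulrA.
  rewrite vM CabsV CabsX v_theta ler_pM ?invr_ge0 ?exprn_ge0 ?(ltW q_gt0) //.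
    exact: geometric_le.
  by rewrite (le_trans (aP d).2) // /M le_max lexx.
have [_ /(_ c cK cz0) c0] := hz.
have [d _ dP] := sP 1%N 0%N; have /eqP[] := X0 d.
rewrite dP //; apply/colP => i; rewrite mxE.
exact: digit_sum_limit_neq0 (cP i) (c0 i).
Qed.

(** Multiplying a nonzero [a] by ['X^d] keeps the pairing at 0 but makes the degree large, against
    discreteness. *)
Lemma pairing_eq0 a : pairing iota theta z a = 0 -> a = 0.
Proof.
move=> za0; apply: contrapT => /eqP/cV0Pn[i ai0].
have [d dP] := lattice_discrete 0.
suff : 0 < v (pairing iota theta z ('X^d *: a)).
  by rewrite pairing_scaleXn za0 mulr0 (ultranorm0 v_norm) ltxx.
apply: dP; exists i; rewrite mxE mulrC size_mulXn //.
by rewrite -[X in (X < _)%N]addn0 ltn_add2l size_poly_gt0.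
Qed.

(** * Truncated Eisenstein series and their convergence *)

Section Summation.
Variables (T : comNzRingType) (N : T -> R) (j : {rmorphism {poly C} -> T}).
Hypothesis hT : is_Tate v N j.

Let N_norm : is_ultranorm N := compl_norm hT.

(** F_q-coordinates on the vectors of polynomials of degree less than [d], in the row-vector form
    used for power sums. *)
Definition polys_of_digits d (x : 'rV[F]_(r * d)) : 'cV[{poly F}]_r :=
  \col_i rVpoly (row i (vec_mx x)).

Lemma polys_of_digitsP d c (x y : 'rV[F]_(r * d)) :
  polys_of_digits (c *: x + y) = c%:P *: polys_of_digits x + polys_of_digits y.
Proof.
by apply/colP => i; rewrite !mxE !linearP mul_polyC.
Qed.

Lemma polys_of_digits_inj d : injective (@polys_of_digits d).
Proof.
move=> x y eq_xy; apply: (can_inj vec_mxK); apply/row_matrixP => i.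
apply: (can_inj rVpolyK); by have /colP/(_ i) := eq_xy; rewrite !mxE.
Qed.

Lemma polys_of_digits_surj d (a : 'cV[{poly F}]_r) :
  (forall i, size (a i 0%R) <= d)%N -> exists x : 'rV_(r * d), a = polys_of_digits x.
Proof.
move=> size_a; exists (mxvec (\matrix_i poly_rV (a i 0))).
by apply/colP => i; rewrite mxE mxvecK rowK poly_rV_K.
Qed.

(** [insub] drops the zero vector, so the set lives in the index type of the Eisenstein series. *)
Definition lattice_ball d : {fset {a : 'cV[{poly F}]_r | a != 0}} :=
  [fset a in pmap insub [seq polys_of_digits x | x : 'rV[F]_(r * d)]]%fset.

Lemma in_lattice_ball d a :
  (a \in lattice_ball d) = [forall i, (size (val a i 0%R) <= d)%N].
Proof.
rewrite inE /= mem_pmap_sub; apply/mapP/forallP => [[x _ ax] i|size_a].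
  by rewrite (ax : val a = _) mxE size_poly.
have [x ax] := polys_of_digits_surj size_a.
by exists x => //; rewrite mem_enum.
Qed.

Lemma partial_sum_lattice_ball d (f : 'cV[{poly F}]_r -> T) :
  partial_sum (fun a : {a : 'cV[{poly F}]_r | a != 0} => f (val a)) (lattice_ball d) =
  \sum_(x : 'rV[F]_(r * d) | x != 0) f (polys_of_digits x).
Proof.
pose s : seq {a : 'cV[{poly F}]_r | a != 0} :=
  pmap insub [seq polys_of_digits x | x : 'rV[F]_(r * d)].
have s_uniq : uniq s.
  by rewrite pmap_sub_uniq // map_inj_uniq ?enum_uniq //; exact: polys_of_digits_inj.
rewrite /partial_sum -(big_seq_fsetE _ _ predT (fun a => f (val a))) /=.
rewrite (perm_big s) /=; last first.
  by apply: uniq_perm => [|//|a]; [exact: fset_uniq | rewrite inE].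
rewrite -(big_map val predT f) (pmap_filter (insubK _)) big_filter.
rewrite big_map big_enum_cond /=; apply: eq_bigl => x /=.
rewrite isSome_insub; congr (~~ _).
rewrite -(inj_eq (@polys_of_digits_inj d)); congr (_ == _).
by apply/colP => i; rewrite !mxE !linear0.
Qed.

Lemma gauss_norm_scale_map_le c (p : {poly F}) :
  gauss_norm v (c *: map_poly iota p) <= v c.
Proof.
rewrite /gauss_norm; apply: bigmax_le => // i _.
by rewrite coefZ coef_map vM /= ler_piMr // Cabs_iota_le1.
Qed.

Lemma Eisenstein_term_le k (a : 'cV[{poly F}]_r) i :
  N (j (pairing iota theta z a ^- k)%:P * rho_t iota j a i 0)
    <= v (pairing iota theta z a) ^- k.
Proof.
rewrite mxE /chi_t -rmorphM mul_polyC (compl_isometry hT).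
by rewrite (le_trans (gauss_norm_scale_map_le _ _)) // CabsV CabsX.
Qed.

Lemma Eisenstein_cvg k i : (0 < k)%N ->
  ncvg N (fun d => \sum_(x : 'rV[F]_(r * d) | x != 0)
      j (pairing iota theta z (polys_of_digits x) ^- k)%:P
        * rho_t iota j (polys_of_digits x) i 0)
    (Eisenstein iota theta N j k z i 0).
Proof.
move=> k0; rewrite mxE.
under eq_fun do rewrite -(partial_sum_lattice_ball _ (fun a =>
  j (pairing iota theta z a ^- k)%:P * rho_t iota j a i 0)).
apply: (ncvg_nsum N_norm) (compl_complete hT) _ _.
  move=> m n le_mn; apply/fsubsetP => a; rewrite !in_lattice_ball => /forallP am.
  by apply/forallP => l; rewrite (leq_trans (am l)).
(* [e^-1] makes the reciprocal small; 1 ensures that raising to the power [k >= 1] does not decrease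
   the absolute value. *)
move=> e e0; have [d dP] := lattice_discrete (Num.max 1 e^-1).
exists d => a; rewrite in_lattice_ball negb_forall => /existsP[l].
rewrite -ltnNge => ld; have := dP (val a) (ex_intro _ l ld).
rewrite gt_max => /andP[v1 ve].
have v0 := lt_trans ltr01 v1.
apply: le_trans (Eisenstein_term_le _ _ _) _.
rewrite -[e]invrK lef_pV2 ?posrE ?invr_gt0 ?exprn_gt0 //.
by rewrite (le_trans (ltW ve)) // -[X in X <= _]expr1 ler_eXn2l.
Qed.

End Summation.
End Lattice.
End Cinfty.

(** * Passage to the limit in the determinant *)

Theorem corollary4p8 (R : realType) (F : finFieldType)
    (C : fieldType) (v : C -> R) (iota : {rmorphism F -> C}) (theta : C)
    (hC : is_Cinfty v iota theta)
    (T : comNzRingType) (N : T -> R) (j : {rmorphism {poly C} -> T})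
    (hT : is_Tate v N j)
    (r : nat) (hr : (2 <= r)%N)
    (k : 'I_r -> nat)
    (hk0 : forall i, (0 < k i)%N)
    (hk1 : forall i, k i = 1 %[mod #|F| - 1])
    (hk : (\sum_(i < r) k i < \sum_(i < r) #|F| ^ i)%N)
    (z : 'rV[C]_r) (hz : Omega v iota theta z) :
  \det (\matrix_(i < r, l < r) Eisenstein iota theta N j (k l) z i 0) = 0.
Proof.
pose u d := \matrix_(i < r, l < r) \sum_(x : 'rV[F]_(r * d) | x != 0)
  j (pairing iota theta z (polys_of_digits x) ^- k l)%:P
    * rho_t iota j (polys_of_digits x) i 0.
have u_det d : \det (u d) = 0.
  (* [C] maps to the Tate algebra as constants; both [z a] and the entries of [rho_t a] are
     F_q-linear in the coordinates of [a]. *)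
  apply: (@det_power_sum_eq0 F C iota T (j \o polyC) r (r * d)
    (fun x => pairing iota theta z (polys_of_digits x))
    (fun i x => rho_t iota j (polys_of_digits x) i 0)) => //.
  - by move=> c x y; rewrite polys_of_digitsP pairing_scale_polyC.
  - move=> x /(pairing_eq0 hC hz) x0; apply: (@polys_of_digits_inj _ _ d).
    by rewrite x0; apply/colP => i; rewrite !mxE !linear0.
  move=> i c x y; rewrite polys_of_digitsP !mxE /chi_t.
  by rewrite rmorphD rmorphM /= map_polyC rmorphD rmorphM.
have N_norm := compl_norm hT.
apply: (ncvg_unique N_norm) (ncvg_cst N_norm 0).
have : ncvg N (fun d => \det (u d))
    (\det (\matrix_(i < r, l < r) Eisenstein iota theta N j (k l) z i 0)).
  apply: (ncvg_det N_norm) => i l; rewrite mxE.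
  under eq_fun do rewrite mxE.
  exact: (Eisenstein_cvg hC hz hT).
by under eq_fun do rewrite u_det.
Qed.
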